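(* Let $(\mathcal S,\{M_n(\mathcal S)^+\}_{n=1}^\infty,1_{\mathcal S})$ and $(\mathcal T,\{M_n(\mathcal T)^+\}_{n=1}^\infty,1_{\mathcal T})$ be operator systems, and let $\lambda=(\lambda_n)_{n\in\mathbb N}$ be a sequence of bilinear maps (satisfying the standing conditions listed in the context) that satisfies (O1), (O2) and (O3). Then the family $\{\mathcal C_n\}_{n=1}^\infty$, $$\mathcal C_n=\{\alpha\otimes_{\lambda_j}(s,t)\alpha^*: s\in M_j(\mathcal S)^+,\ t\in M_j(\mathcal T)^+,\ \alpha\in M_{n,\tau(j)},\ j\in\mathbb N\}\subseteq M_n(\mathcal S\otimes\mathcal T),$$ is a matrix ordering on the algebraic tensor product $\mathcal S\otimes\mathcal T$ with order unit $1_{\mathcal S}\otimes1_{\mathcal T}$.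
   Context: **Matrices.** $M_{k,l}$ denotes the complex $k\times l$ matrices with operator norm, $M_k=M_{k,k}$, and $M_{k,l}(W)=M_{k,l}\otimes W$ for a vector space $W$. $\varepsilon^{[k]}_{i,j}\in M_k$ is the matrix unit with $1$ in position $(i,j)$, with the convention $\varepsilon^{[k]}_{i,j}=0$ if $(i,j)\notin\{1,\dots,k\}^2$; $\varepsilon^{[k]}_j=\varepsilon^{[k]}_{j,j}$. $I_p$ is the identity of $M_p$. **$\lambda$-theory (bilinear case $m=2$).** $\lambda=(\lambda_k)_{k\in\mathbb N}$ is a sequence of bilinear maps $\lambda_k:M_k\times M_k\to M_{\tau(k)}$ with $\tau(k)\in\mathbb N$; $\|\lambda_k\|$ is its norm as a bounded bilinear map. For vector spaces $V_1,V_2$, $\otimes_{\lambda_k}:M_k(V_1)\times M_k(V_2)\to M_{\tau(k)}(V_1\otimes V_2)$ is the bilinear map with $\otimes_{\lambda_k}(\alpha_1\otimes v_1,\alpha_2\otimes v_2)=\lambda_k(\alpha_1,\alpha_2)\otimes v_1\otimes v_2$. **Standing conditions on $\lambda$.** (N1) $\tau(1)=1$. (N2) $\|\lambda_j\|=1$ for all $j$. (E1) For all $k$ there exist $p\in\mathbb N$, $S\in M_{k,\tau(p)}$, $T\in M_{\tau(p),k}$, $a_1,\dots,a_k\in M_p$ such that for all $j_1,j_2\in\{1,\dots,k\}$, $S\lambda_p(a_{j_1},a_{j_2})T=\varepsilon_j^{[k]}$ if $j_1=j_2=j$, and $=0$ otherwise. (E2) For all $r,s\in\mathbb N$ there is $P\in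 M_{\tau(r)+\tau(s),\tau(r+s)}$ with $\|P\|\le1$ such that for all $(i_1,j_1),(i_2,j_2)\in\{1,\dots,r\}^2\cup\{r+1,\dots,r+s\}^2$, $P\lambda_{r+s}(\varepsilon^{[r+s]}_{i_1,j_1},\varepsilon^{[r+s]}_{i_2,j_2})P^*=\mathrm{diag}\big(\lambda_r(\varepsilon^{[r]}_{i_1,j_1},\varepsilon^{[r]}_{i_2,j_2}),\lambda_s(\varepsilon^{[s]}_{i_1-r,j_1-r},\varepsilon^{[s]}_{i_2-r,j_2-r})\big).$ (E3) $\lambda_1(1,1)=1$ and $\sup_k\|\lambda_k\|<\infty$. (W1) For all $\gamma\in M_p$ there are $P\in M_{p,\tau(p)}$, $Q\in M_{\tau(p),p}$ with $\|P\|,\|Q\|\le1$ and $\gamma=P\lambda_p(\gamma,I_p)Q$; likewise with $\lambda_p(I_p,\gamma)$. (W2) For all $\alpha_1,\alpha_2\in M_p$, $\beta_1,\beta_2\in M_q$ there are $S\in M_{\tau(p)\tau(q),\tau(pq)}$, $T\in M_{\tau(pq),\tau(p)\tau(q)}$ with $\|S\|,\|T\|\le1$ and $\lambda_p(\alpha_1,\alpha_2)\otimes\lambda_q(\beta_1,\beta_2)=S\lambda_{pq}(\alpha_1\otimes\beta_1,\alpha_2\otimes\beta_2)T$. **Further conditions.** (O1) For each $r$ and all $(i_k,j_k)\in\{1,\dots,r\}^2$: $\lambda_r(\varepsilon^{[r]}_{i_1,j_1},\varepsilon^{[r]}_{i_2,j_2})=\lambda_r(\varepsilon^{[r]}_{j_1,i_1},\varepsilon^{[r]}_{j_2,i_2})^*$.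 (O2) For each $r$, the matrix $P\in M_{2\tau(r),\tau(2r)}$, $\|P\|\le1$, of (E2) with $s=r$ also satisfies, for all $(i_1,j_1),(i_2,j_2)\in R\cup S$, where $R=\{1,\dots,r\}\times\{r+1,\dots,2r\}$ and $S=\{r+1,\dots,2r\}\times\{1,\dots,r\}$, $$P\lambda_{2r}(\varepsilon^{[2r]}_{i_1,j_1},\varepsilon^{[2r]}_{i_2,j_2})P^*=\begin{pmatrix}0&\lambda_r(\varepsilon^{[r]}_{i_1,j_1-r},\varepsilon^{[r]}_{i_2,j_2-r})\\ \lambda_r(\varepsilon^{[r]}_{i_1-r,j_1},\varepsilon^{[r]}_{i_2-r,j_2})&0\end{pmatrix}.$$ (O3) For each $r$ and all $p_1,p_2\in\mathbb N$, the bilinear map $M_r(M_{p_1})\times M_r(M_{p_2})\to M_{\tau(r)}(M_{p_1p_2})$ obtained by tensorizing $\lambda_r$ with the Kronecker product, i.e. $(\beta_1\otimes\alpha_1,\beta_2\otimes\alpha_2)\mapsto\lambda_r(\beta_1,\beta_2)\otimes\alpha_1\otimes\alpha_2$ for $\beta_i\in M_r$, $\alpha_i\in M_{p_i}$, is positive: it maps pairs of positive elements to positive elements. **Operator systems.** For a complex $*$-vector space $V$, $M_n(V)$ has the involution $[v_{ij}]^*=[v_{ji}^*]$. A matrix ordering on $V$ is a family $\{C_n\}$ of proper cones $C_n\subseteq M_n(V)_{sa}$ (so $C_n\cap(-C_n)=\{0\}$) with $A^*C_nA\subseteq C_k$ for all $A\in M_{n,k}$. An (abstract) operator system is a triple $(V,\{C_n\},e)$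 with $\{C_n\}$ a matrix ordering and $e\in V_{sa}$ an Archimedean matrix order unit: with $e_n=\mathrm{diag}(e,\dots,e)$, for each $n$ and $v\in M_n(V)_{sa}$ there is $r>0$ with $re_n-v\in C_n$, and $se_n+v\in C_n$ for all $s>0$ implies $v\in C_n$. An element $e\in V_{sa}$ is an order unit for $V$ if for every $v\in V_{sa}$ there is $r>0$ with $re-v\in C_1$. $\mathcal S\otimes\mathcal T$ carries the involution $(s\otimes t)^*=s^*\otimes t^*$. *)

(* Defs.v *)
From HB Require Import structures.
From mathcomp Require Import all_boot all_order all_algebra.
From mathcomp Require Import sesquilinear spectral.
From mathcomp Require Import complex mxtens.
From mathcomp Require Import boolp classical_sets reals.

Set Implicit Arguments.
Unset Strict Implicit.
Unset Printing Implicit Defensive.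

Import Order.TTheory GRing.Theory Num.Theory.

Local Open Scope classical_set_scope.
Local Open Scope sesquilinear_scope.
Local Open Scope ring_scope.
Local Open Scope complex_scope.

HB.mixin Record Lmodule_hasStar (R : rcfType) V of GRing.Lmodule R[i] V := {
  star : V -> V;
  star_antilinear :
    forall (a : R[i]) (u v : V), star (a *: u + v) = a^* *: star u + star v;
  starK : involutive star
}.

#[short(type="starLmodType")]
HB.structure Definition StarLmodule (R : rcfType) :=
  {V of Lmodule_hasStar R V & GRing.Lmodule R[i] V}.

Section MatricesOver.
Context {C : pzRingType} {V : lmodType C}.

Definition lactmx m n p (A : 'M[C]_(m, n)) (X : 'M[V]_(n, p)) : 'M[V]_(m, p) :=
  \matrix_(i, j) \sum_k A i k *: X k j.

Definition ractmx m n p (X : 'M[V]_(m, n)) (A : 'M[C]_(n, p)) : 'M[V]_(m, p) :=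
  \matrix_(i, j) \sum_k A k j *: X i k.

(* The elementary tensor A ⊗ v of M_{m,n}(V) = M_{m,n} ⊗ V. *)
Definition elemmx m n (A : 'M[C]_(m, n)) (v : V) : 'M[V]_(m, n) :=
  \matrix_(i, j) (A i j *: v).

End MatricesOver.

Definition starmx (R : rcfType) (V : starLmodType R) n (X : 'M[V]_n) : 'M[V]_n :=
  \matrix_(i, j) star (X j i).

(* A X A^* for a scalar matrix A. *)
Definition congmx (R : rcfType) (V : lmodType R[i]) n k
    (A : 'M[R[i]]_(n, k)) (X : 'M[V]_k) : 'M[V]_n :=
  ractmx (lactmx A X) (A ^t*).

(* Indices are natural numbers starting at 1, so that truncated subtraction
   respects the convention that an out-of-range matrix unit is 0: if i <= r then
   i - r = 0 is out of range. *)
Definition munit (C : pzRingType) k (i j : nat) : 'M[C]_k :=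
  \matrix_(a, b) ((a.+1 == i) && (b.+1 == j))%:R.

Section Norms.
Context {R : realType}.

Definition l2norm n (v : 'cV[R[i]]_n) : R :=
  Num.sqrt (\sum_i Normc.normc (v i 0) ^+ 2).

Definition opnorm m n (A : 'M[R[i]]_(m, n)) : R :=
  sup [set l2norm (A *m v) | v in [set v : 'cV_n | l2norm v <= 1]].

Definition bilnorm k l (b : 'M[R[i]]_k -> 'M[R[i]]_k -> 'M[R[i]]_l) : R :=
  sup [set x | exists A B, [/\ opnorm A <= 1, opnorm B <= 1 & x = opnorm (b A B)]].

Definition psdmx n (A : 'M[R[i]]_n) : Prop :=
  A ^t* = A /\ forall v : 'cV[R[i]]_n, 0 <= (v ^t* *m A *m v) 0 0.

End Norms.

(* For bilinear lam and b, the bilinear map M_k(V1) x M_k(V2) -> M_l(W) sending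
   (A1 ⊗ v1, A2 ⊗ v2) to lam A1 A2 ⊗ b v1 v2, expanded over the matrix units;
   see tens_lambda_elemmx. *)
Definition tens_lambda (C : pzRingType) (V1 V2 W : lmodType C) k l
    (lam : 'M[C]_k -> 'M[C]_k -> 'M[C]_l) (b : V1 -> V2 -> W)
    (X : 'M[V1]_k) (Y : 'M[V2]_k) : 'M[W]_l :=
  \sum_(i1 < k) \sum_(j1 < k) \sum_(i2 < k) \sum_(j2 < k)
    elemmx (lam (delta_mx i1 j1) (delta_mx i2 j2)) (b (X i1 j1) (Y i2 j2)).

Lemma tens_lambda_elemmx (C : comNzRingType) (V1 V2 W : lmodType C) k l
    (lam : {bilinear 'M[C]_k -> 'M[C]_k -> 'M[C]_l})
    (b : {bilinear V1 -> V2 -> W}) (A1 A2 : 'M[C]_k) (v1 : V1) (v2 : V2) :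
  tens_lambda lam b (elemmx A1 v1) (elemmx A2 v2) =
  elemmx (lam A1 A2) (b v1 v2).
Proof.
rewrite [in RHS](matrix_sum_delta A1) [in RHS](matrix_sum_delta A2).
have elemD m n (v : W) (A B : 'M[C]_(m, n)) : elemmx (A + B) v = elemmx A v + elemmx B v.
  by apply/matrixP => i j; rewrite !mxE scalerDl.
have elem0 m n (v : W) : elemmx (0 : 'M[C]_(m, n)) v = 0.
  by apply/matrixP => i j; rewrite !mxE scale0r.
have elemS (v : W) I (r : seq I) (F : I -> 'M[C]_l) :
    elemmx (\sum_(i <- r) F i) v = \sum_(i <- r) elemmx (F i) v.
  by elim/big_rec2: _ => [|i x y _ <-]; rewrite ?elemD ?elem0.
rewrite linear_sumlz elemS; apply: eq_bigr => i1 _.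
rewrite linear_sumlz elemS; apply: eq_bigr => j1 _.
rewrite linear_sumr elemS; apply: eq_bigr => i2 _.
rewrite linear_sumr elemS; apply: eq_bigr => j2 _.
rewrite !mxE linearZl_LR linearZr_LR linearZl_LR linearZr_LR.
by apply/matrixP => i j; rewrite !mxE !scalerA; congr (_ *: _); rewrite mulrC mulrA.
Qed.

Section OperatorSystems.
Context {R : realType} {V : starLmodType R}.
Implicit Types (D : forall n, set 'M[V]_n) (e : V).

Record matrix_ordering D : Prop := MatrixOrdering {
  mo_sa : forall n, (0 < n)%N -> forall X, D n X -> starmx X = X;
  mo_add : forall n, (0 < n)%N -> forall X Y, D n X -> D n Y -> D n (X + Y);
  mo_scale : forall n, (0 < n)%N ->
    forall (r : R) X, 0 <= r -> D n X -> D n (map_mx (fun v => r%:C *: v) X);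
  mo_proper : forall n, (0 < n)%N -> D n `&` [set X | D n (- X)] = [set 0];
  mo_compat : forall n k, (0 < n)%N -> (0 < k)%N ->
    forall (A : 'M[R[i]]_(n, k)) X, D n X -> D k (ractmx (lactmx (A ^t*) X) A)
}.

Definition order_unit D e : Prop :=
  star e = e /\
  forall v : V, star v = v ->
    exists2 r : R, 0 < r & D 1%N (r%:C *: e - v)%:M.

Definition archimedean_matrix_order_unit D e : Prop :=
  star e = e /\
  forall n, (0 < n)%N -> forall v : 'M[V]_n, starmx v = v ->
    (exists2 r : R, 0 < r & D n ((r%:C *: e)%:M - v)) /\
    ((forall s : R, 0 < s -> D n ((s%:C *: e)%:M + v)) -> D n v).

Definition operator_system D e : Prop :=
  matrix_ordering D /\ archimedean_matrix_order_unit D e.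

End OperatorSystems.

(* (W, tens) is the algebraic tensor product of S and T, with its involution. *)
Record star_tensor_product (R : rcfType) (S T W : starLmodType R)
    (tens : {bilinear S -> T -> W}) : Prop := StarTensorProduct {
  tens_exists : forall (U : lmodType R[i]) (b : {bilinear S -> T -> U}),
    exists f : {linear W -> U}, forall s t, f (tens s t) = b s t;
  tens_unique : forall (U : lmodType R[i]) (f g : {linear W -> U}),
    (forall s t, f (tens s t) = g (tens s t)) -> f =1 g;
  star_tens : forall s t, star (tens s t) = tens (star s) (star t)
}.

Section Lambda.
Context {R : realType} (tau : nat -> nat).
Context (lam : forall k, {bilinear 'M[R[i]]_k -> 'M[R[i]]_k -> 'M[R[i]]_(tau k)}).
Local Notation C := R[i].
Local Notation eps := (munit C).

Definition condN1 : Prop := tau 1%N = 1%N.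

Definition condN2 : Prop := forall j, (0 < j)%N -> bilnorm (lam j) = 1.

Definition condE1 : Prop := forall k, (0 < k)%N ->
  exists p (S : 'M[C]_(k, tau p)) (T : 'M[C]_(tau p, k)) (a : 'I_k -> 'M[C]_p),
    (0 < p)%N /\
    forall j1 j2, S *m lam p (a j1) (a j2) *m T =
      if j1 == j2 then delta_mx j1 j1 else 0.

Definition in_sq (a b : nat) (ij : nat * nat) : bool :=
  (a < ij.1 <= b)%N && (a < ij.2 <= b)%N.

Definition E2_equations r s (P : 'M[C]_(tau r + tau s, tau (r + s))) : Prop :=
  forall i1 j1 i2 j2 : nat,
    in_sq 0 r (i1, j1) || in_sq r (r + s) (i1, j1) ->
    in_sq 0 r (i2, j2) || in_sq r (r + s) (i2, j2) ->
    P *m lam (r + s) (eps _ i1 j1) (eps _ i2 j2) *m P ^t* =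
    block_mx (lam r (eps _ i1 j1) (eps _ i2 j2)) 0
             0 (lam s (eps _ (i1 - r) (j1 - r)) (eps _ (i2 - r) (j2 - r))).

Definition condE2 : Prop := forall r s, (0 < r)%N -> (0 < s)%N ->
  exists P, opnorm P <= 1 /\ @E2_equations r s P.

Definition condE3 : Prop :=
  lam 1%N 1%:M 1%:M = 1%:M /\
  exists M : R, forall k, (0 < k)%N -> bilnorm (lam k) <= M.

Definition condW1 : Prop := forall p, (0 < p)%N -> forall G : 'M[C]_p,
  (exists (P : 'M[C]_(p, tau p)) (Q : 'M[C]_(tau p, p)),
    [/\ opnorm P <= 1, opnorm Q <= 1 & G = P *m lam p G 1%:M *m Q]) /\
  (exists (P : 'M[C]_(p, tau p)) (Q : 'M[C]_(tau p, p)),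
    [/\ opnorm P <= 1, opnorm Q <= 1 & G = P *m lam p 1%:M G *m Q]).

Definition condW2 : Prop := forall p q, (0 < p)%N -> (0 < q)%N ->
  forall (A1 A2 : 'M[C]_p) (B1 B2 : 'M[C]_q),
  exists (S : 'M[C]_(tau p * tau q, tau (p * q)))
         (T : 'M[C]_(tau (p * q), tau p * tau q)),
    [/\ opnorm S <= 1, opnorm T <= 1 &
        lam p A1 A2 *t lam q B1 B2 =
        S *m lam (p * q) (A1 *t B1) (A2 *t B2) *m T].

Definition standing_conditions : Prop :=
  (forall k, (0 < k)%N -> (0 < tau k)%N) /\
  [/\ condN1, condN2, condE1, condE2 & condE3] /\ condW1 /\ condW2.

Definition condO1 : Prop := forall r, (0 < r)%N ->
  forall i1 j1 i2 j2 : nat, in_sq 0 r (i1, j1) -> in_sq 0 r (i2, j2) ->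
    lam r (eps _ i1 j1) (eps _ i2 j2) = (lam r (eps _ j1 i1) (eps _ j2 i2)) ^t*.

Definition in_offdiag r (ij : nat * nat) : bool :=
  (0 < ij.1 <= r)%N && (r < ij.2 <= r + r)%N ||
  (r < ij.1 <= r + r)%N && (0 < ij.2 <= r)%N.

Definition O2_equations r (P : 'M[C]_(tau r + tau r, tau (r + r))) : Prop :=
  forall i1 j1 i2 j2 : nat, in_offdiag r (i1, j1) -> in_offdiag r (i2, j2) ->
    P *m lam (r + r) (eps _ i1 j1) (eps _ i2 j2) *m P ^t* =
    block_mx 0 (lam r (eps _ i1 (j1 - r)) (eps _ i2 (j2 - r)))
             (lam r (eps _ (i1 - r) j1) (eps _ (i2 - r) j2)) 0.

Definition condO2 : Prop := forall r, (0 < r)%N ->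
  exists P, [/\ opnorm P <= 1, @E2_equations r r P & @O2_equations r P].

(* The identification M_r(M_p) = M_{rp}, through which positivity is defined. *)
Definition flatmx r p (X : 'M['M[C]_p]_r) : 'M[C]_(r * p) :=
  \sum_(i < r) \sum_(j < r) delta_mx i j *t X i j.

Definition condO3 : Prop := forall r p1 p2,
  (0 < r)%N -> (0 < p1)%N -> (0 < p2)%N ->
  forall (X : 'M['M[C]_p1]_r) (Y : 'M['M[C]_p2]_r),
    psdmx (flatmx X) -> psdmx (flatmx Y) ->
    psdmx (flatmx (tens_lambda (lam r) (@tensmx C p1 p1 p2 p2) X Y)).

Definition lambda_cone (S T W : starLmodType R) (tens : {bilinear S -> T -> W})
    (PS : forall n, set 'M[S]_n) (PT : forall n, set 'M[T]_n)
    (n : nat) : set 'M[W]_n :=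
  [set X | exists j (s : 'M[S]_j) (t : 'M[T]_j) (A : 'M[C]_(n, tau j)),
    [/\ (0 < j)%N, PS j s, PT j t & X = congmx A (tens_lambda (lam j) tens s t)]].

End Lambda.

(* Main.v *)
(* The functionals f ⊗ g, with f and g positive on the ground cones of S and T,
   separate the points of the tensor product: on an operator system positive
   functionals separate points by Hahn-Banach.  Applied entrywise, f ⊗ g sends
   α ⊗_λ(s,t) α^* to α λ(f(s), g(t)) α^*, which is positive semidefinite by (O3)
   with p_1 = p_2 = 1; hence elements of the cone are self-adjoint and the cone is
   proper.  The same functionals turn every identity in M_n(S ⊗ T) into one
   between complex matrices; closure under sums is then (E2) applied to direct
   sums.  The order unit comes from
   (k - a) ⊗ (l + c) + (k + a) ⊗ (l - c) = 2kl 1⊗1 - 2 a ⊗ c. *)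
Require Import Defs.
From HB Require Import structures.
From mathcomp Require Import all_boot all_order all_algebra ring lra.
From mathcomp Require Import sesquilinear spectral.
From mathcomp Require Import complex mxtens.
From mathcomp Require Import boolp classical_sets reals.

Set Implicit Arguments.
Unset Strict Implicit.
Unset Printing Implicit Defensive.

Import Order.TTheory GRing.Theory Num.Theory.

Local Open Scope classical_set_scope.
Local Open Scope sesquilinear_scope.
Local Open Scope ring_scope.
Local Open Scope complex_scope.

(** * Positive functionals on order unit spaces *)

Section ConeFunctional.
Context {R : realType} {E : lmodType R}.
Implicit Types (K M : set E) (e u v : E).

Definition convex_cone K : Prop :=
  (forall u v, K u -> K v -> K (u + v)) /\
  (forall (t : R) u, 0 <= t -> K u -> K (t *: u)).

Lemma maximal_cone K e : convex_cone K -> ~ K (- e) ->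
  exists M, [/\ K `<=` M, convex_cone M, ~ M (- e) &
    forall N, convex_cone N -> M `<=` N -> ~ N (- e) -> N `<=` M].
Proof.
move=> [KD KZ] Ke.
(* K is added to A so that the empty chain is no exception. *)
pose P := [set A | convex_cone (K `|` A) /\ ~ (K `|` A) (- e)].
have [F FP Ftot|A [[Acone Ae] Amax]] := @Zorn_bigcup E P.
  split; last by case=> // -[A FA Ae]; case: (FP A FA) => _; apply; right.
  have Fadd A u v : F A -> (K `|` A) u -> (K `|` A) v ->
      (K `|` \bigcup_(X in F) X) (u + v).
    move=> FA Au Av; case: (FP A FA) => -[AD _] _.
    by case: (AD u v Au Av); [left | right; exists A].
  split=> [u v [Ku|[A FA Au]] [Kv|[B FB Bv]]|t u t0 [Ku|[A FA Au]]].
  - by left; exact: KD.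
  - by apply: (Fadd B) => //; [left|right].
  - by apply: (Fadd A) => //; [right|left].
  - case: (Ftot A B FA FB) => AB.
    + by apply: (Fadd B) => //; right => //; apply: AB.
    + by apply: (Fadd A) => //; right => //; apply: AB.
  - by left; exact: KZ.
  - case: (FP A FA) => -[_ AZ] _.
    by case: (AZ t u t0 (or_intror Au)); [left | right; exists A].
exists (K `|` A); split=> //.
move=> N Ncone KAN Ne x Nx; apply: contrapT => KAx.
have NE : K `|` N = N by apply: setUidr => y Ky; apply: KAN; left.
apply: (Amax N); last by split; rewrite NE.
split; first by move=> y Ay; apply: KAN; right.
by move=> /(_ x Nx) Ax; apply: KAx; right; exact: Ax.
Qed.

(** If neither [v] nor [- v] were in a maximal [M], adjoining either one would capture [- e]. Then
    [- e - s *: v] and [- e + t *: v] lie in [M] for some positive [s] and [t]; the weights [t] and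
    [s] cancel [v] and force [- e] into [M]. *)
Lemma maximal_cone_total K e : K e -> convex_cone K -> ~ K (- e) ->
  exists M, [/\ K `<=` M, convex_cone M, ~ M (- e) & forall v, M v \/ M (- v)].
Proof.
move=> Ke Kcone KNe; have [M [KM Mcone MNe Mmax]] := maximal_cone Kcone KNe.
exists M; split=> // v; case: (Mcone) => MD MZ.
have M0 : M 0 by rewrite -(scale0r e); apply: MZ => //; exact: KM.
have extend w : ~ M w -> exists2 t, 0 < t & M (- e - t *: w).
  (* [N] is [M] enlarged by the ray through [w]. *)
  move=> Mw; pose N := [set x | exists2 t : R, 0 <= t & M (x - t *: w)].
  have Ncone : convex_cone N.
    split=> [x y [s s0 Mx] [t t0 My]|s x s0 [t t0 Mx]].
      exists (s + t); first exact: addr_ge0.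
      by rewrite scalerDl opprD addrACA; exact: MD.
    exists (s * t); first exact: mulr_ge0.
    by rewrite -scalerA -scalerBr; exact: MZ.
  have [[t t0 Me]|Ne] := pselect (N (- e)).
    exists t => //; rewrite lt_neqAle t0 andbT eq_sym.
    by apply/eqP => tE; apply: MNe; move: Me; rewrite tE scale0r subr0.
  case: Mw; apply: (Mmax N) => //.
    by move=> x Mx; exists 0 => //; rewrite scale0r subr0.
  by exists 1 => //; rewrite scale1r subrr.
have [|Mv] := pselect (M v); first by left.
right; apply: contrapT => MNv.
have [s s0 Ms] := extend _ Mv; have [t t0 Mt] := extend _ MNv.
apply: MNe.
have := MD _ _ (MZ _ _ (ltW t0) Ms) (MZ _ _ (ltW s0) Mt).
rewrite !scalerBr !scalerN !scalerA (mulrC s) opprK addrACA addNr addr0 -opprD -scalerDl.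
move=> /(MZ (t + s)^-1); rewrite scalerN scalerA mulVf ?scale1r; last first.
  by rewrite gt_eqF // addr_gt0.
by apply; rewrite invr_ge0 addr_ge0 // ltW.
Qed.

(** Extend [K] to a total cone [M]. For each [v] the reals [r] with [v - r *: e] in [M] form a cut,
    and [f v] is its supremum. This defines [f] on the whole space at once; linearity follows
    because the value at the cut is unique. *)
Lemma positive_functional K e :
  convex_cone K -> ~ K (- e) -> (forall v, exists2 r : R, 0 < r & K (r *: e - v)) ->
  exists f : {linear E -> R^o}, f e = 1 /\ forall v, K v -> 0 <= f v.
Proof.
move=> Kcone KNe Kunit.
have Ke : K e.
  have [r r0] := Kunit 0; rewrite subr0 => /(Kcone.2 r^-1).
  by rewrite scalerA mulVf ?gt_eqF// scale1r; apply; rewrite invr_ge0 ltW.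
have [M [KM [MD MZ] MNe Mtot]] := maximal_cone_total Ke Kcone KNe.
have Me_ge0 r : M (r *: e) -> 0 <= r.
  move=> Mr; rewrite leNgt; apply/negP => r0; apply: MNe.
  move: Mr => /(MZ (- r)^-1); rewrite scalerA invrN mulNr mulVf ?lt_eqF//.
  by rewrite scaleN1r; apply; rewrite -invrN invr_ge0 oppr_ge0 ltW.
have MDe u v (x y : R) : M (u + x *: e) -> M (v + y *: e) -> M (u + v + (x + y) *: e).
  by move=> Mu Mv; rewrite scalerDl addrACA; exact: MD.
have Mup u (x y : R) : x <= y -> M (u + x *: e) -> M (u + y *: e).
  move=> xy Mu; rewrite -(subrK x y) [y - x + x]addrC scalerDl addrA.
  by apply: MD => //; apply: MZ; rewrite ?subr_ge0 //; exact: KM.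
(* Both [v - c *: e] and [c *: e - v] belong to [M] up to an arbitrarily small multiple of [e]; the
   slack [d] allows for an [M] that is not closed. *)
pose is_val v (c : R) := forall d : R, 0 < d ->
  M (v + (d - c) *: e) /\ M (- v + (d + c) *: e).
have val_uniq v c c' : is_val v c -> is_val v c' -> c <= c'.
  move=> vc vc'; apply/ler_addgt0Pl => d d0.
  have d20 : 0 < d / 2 by rewrite divr_gt0.
  have := MDe _ _ _ _ (vc _ d20).1 (vc' _ d20).2; rewrite addrN add0r => /Me_ge0.
  lra.
have val_ex v : exists c, is_val v c.
  pose L := [set r : R | M (v + (- r) *: e)].
  have Lub : has_sup L.
    split.
      have [r _ Kr] := Kunit (- v); exists (- r); rewrite /L /= opprK addrC.
      by apply: KM; rewrite opprK in Kr.
    have [r _ Kr] := Kunit v; exists r => s Ls.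
    rewrite -subr_ge0; apply: Me_ge0.
    have : M (- v + r *: e) by rewrite addrC; exact: KM.
    by move=> /MDe /(_ Ls); rewrite addNr add0r.
  exists (sup L) => d d0; split.
    have [s Ls sd] := sup_adherent d0 Lub.
    by apply: (Mup _ (- s)) => //; lra.
  (* Otherwise totality puts [d + sup L] into [L], above its supremum. *)
  have [|Mn] := Mtot (- v + (d + sup L) *: e); first by [].
  have : d + sup L <= sup L.
    apply: sup_upper_bound => //; rewrite /L /= scaleNr.
    by move: Mn; rewrite opprD opprK.
  lra.
have valD u v c c' : is_val u c -> is_val v c' -> is_val (u + v) (c + c').
  move=> uc vc' d d0; have d20 : 0 < d / 2 by rewrite divr_gt0.
  split; [apply: Mup (MDe _ _ _ _ (uc _ d20).1 (vc' _ d20).1); lra |].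
  rewrite opprD; apply: Mup (MDe _ _ _ _ (uc _ d20).2 (vc' _ d20).2); lra.
have valN v c : is_val v c -> is_val (- v) (- c).
  by move=> vc d /vc []; rewrite !opprK.
have valZp v c (t : R) : 0 < t -> is_val v c -> is_val (t *: v) (t * c).
  move=> t0 vc d d0.
  have [|h1 h2] := vc (t^-1 * d); first by rewrite mulr_gt0 // invr_gt0.
  have tK x : t * (t^-1 * x) = x by rewrite mulrA divff ?mul1r ?gt_eqF.
  split.
    by have := MZ _ _ (ltW t0) h1; rewrite scalerDr scalerA mulrBr tK.
  by have := MZ _ _ (ltW t0) h2; rewrite scalerDr scalerA mulrDr tK scalerN.
have val0 : is_val 0 0.
  move=> d d0; rewrite !oppr0 !addr0 !add0r.
  by split; apply: MZ (KM _ Ke); exact: ltW.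
have valZ v c (t : R) : is_val v c -> is_val (t *: v) (t * c).
  have [t0|t0|-> _] := ltrgt0P t; first exact: valZp.
    move=> vc; rewrite -(opprK t) scaleNr mulNr; apply/valN/valZp => //.
    by rewrite oppr_gt0.
  by rewrite scale0r mul0r.
have [f fP] := choice val_ex.
have f_eq v c : is_val v c -> f v = c.
  by move=> vc; apply/eqP; rewrite eq_le !(val_uniq v).
have f_lin : linear (f : E -> R^o).
  by move=> a u v; apply: f_eq; apply: valD => //; exact: valZ.
pose fL := GRing.isLinear.Build _ _ _ _ _ f_lin.
pose F : {linear E -> R^o} := HB.pack (f : E -> R^o) fL.
exists F; split=> /= [|v Kv].
  apply: f_eq => d d0; rewrite -{1 3}(scale1r e) -scaleNr -!scalerDl.
  by split; apply: MZ (KM _ Ke); lra.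
rewrite leNgt; apply/negP => fv0.
(* With this slack [- v + (f v / 2) *: e] is in [M]; adding [v] leaves a negative multiple of [e] in
   [M]. *)
have := (fP v (- f v / 2) _).2; rewrite divr_gt0 ?oppr_gt0 // => /(_ isT) h.
have := MD _ _ (KM _ Kv) h; rewrite addrA subrr add0r => /Me_ge0; lra.
Qed.

End ConeFunctional.

(** * Positive functionals on operator systems *)

(** Restriction of scalars to the reals, under a name of its own so that the real and the complex
    module structures on one carrier do not compete. *)
Definition realify (R : rcfType) (V : lmodType R[i]) : Type := V.

Section Realify.
Context (R : rcfType) (V : lmodType R[i]).
Implicit Types (r s : R) (u v : V).

Let rscale r v : V := r%:C *: v.

Let rscaleA r s v : rscale r (rscale s v) = rscale (r * s) v.
Proof. by rewrite /rscale scalerA -rmorphM. Qed.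

Let rscale1 : left_id 1 rscale.
Proof. by move=> v; rewrite /rscale rmorph1 scale1r. Qed.

Let rscaleDr : right_distributive rscale +%R.
Proof. by move=> r u v; rewrite /rscale scalerDr. Qed.

Let rscaleDl v : {morph rscale^~ v : r s / r + s}.
Proof. by move=> r s; rewrite /rscale rmorphD scalerDl. Qed.

HB.instance Definition _ := GRing.Zmodule.on (realify V).
HB.instance Definition _ := GRing.Zmodule_isLmodule.Build R (realify V)
  rscaleA rscale1 rscaleDr rscaleDl.

Lemma realifyZ r v : r *: (v : realify V) = r%:C *: v.
Proof. by []. Qed.

End Realify.

Section Star.
Context (R : rcfType) (V : starLmodType R).
Implicit Types (u v : V) (a : R[i]).

Lemma starD u v : star (u + v) = star u + star v.
Proof. by rewrite -[u in LHS]scale1r star_antilinear rmorph1 scale1r. Qed.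

Lemma star0 : star (0 : V) = 0.
Proof. by apply: (addrI (star 0)); rewrite -starD !addr0. Qed.

Lemma starZ a v : star (a *: v) = Num.conj a *: star v.
Proof. by rewrite -[a *: v]addr0 star_antilinear star0 addr0. Qed.

Lemma starZr (r : R) v : star (r%:C *: v) = r%:C *: star v.
Proof. by rewrite starZ; congr (_ *: _); apply/CrealP; rewrite complex_real. Qed.

Lemma starN v : star (- v) = - star v.
Proof. by rewrite -scaleN1r starZ rmorphN rmorph1 scaleN1r. Qed.

Lemma star_sum I (r : seq I) (F : I -> V) :
  star (\sum_(i <- r) F i) = \sum_(i <- r) star (F i).
Proof. by elim/big_rec2: _ => [|i x y _ <-]; rewrite ?star0 ?starD. Qed.

Lemma conj_i : Num.conj ('i : R[i]) = - 'i.
Proof. by apply/eqP; rewrite eq_complex /= oppr0 !eqxx. Qed.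

Lemma cartesian_decomposition v : exists a b : V,
  [/\ star a = a, star b = b & v = a + 'i *: b].
Proof.
have sqri : - 'i * 'i = 1 :> R[i] by rewrite mulNr -expr2 sqr_i opprK.
exists (2^-1%:C *: (v + star v)), (2^-1%:C *: (- 'i *: (v - star v))); split.
- by rewrite starZr starD starK addrC.
- rewrite starZr starZ starD starN starK rmorphN /= conj_i opprK.
  by rewrite -opprB scalerN -scaleNr.
rewrite !scalerA mulrAC [_ * - _]mulrC sqri mul1r -scalerDr.
rewrite addrACA subrr addr0 -mulr2n -scaler_nat scalerA.
by rewrite -(rmorph_nat (real_complex R)) -rmorphM mulVf ?pnatr_eq0 // scale1r.
Qed.

End Star.

Lemma scalar_mx1E (V : nmodType) (X : 'M[V]_1) : (X 0 0)%:M = X.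
Proof. by apply/matrixP => i j; rewrite !mxE !ord1. Qed.

Section GroundCone.
Context {R : realType} {V : starLmodType R} (D : forall n, set 'M[V]_n).
Implicit Types (u v : V).

Definition ground_cone : set V := [set v | D (v%:M : 'M_1)].
Local Notation P := ground_cone.

Hypothesis Dmo : matrix_ordering D.

Lemma ground_sa v : P v -> star v = v.
Proof.
case: Dmo => Dsa _ _ _ _ /Dsa => /(_ isT) /matrixP /(_ 0 0).
by rewrite !mxE.
Qed.

Lemma groundD u v : P u -> P v -> P (u + v).
Proof.
case: Dmo => _ + _ _ _ Pu Pv => /(_ 1%N isT _ _ Pu Pv).
by rewrite /P /=; congr D; apply/matrixP => i j; rewrite !mxE !ord1.
Qed.

Lemma groundZ (r : R) v : 0 <= r -> P v -> P (r%:C *: v).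
Proof.
case: Dmo => _ _ + _ _ r0 Pv => /(_ 1%N isT r _ r0 Pv).
by rewrite /P /=; congr D; apply/matrixP => i j; rewrite !mxE !ord1.
Qed.

Lemma ground_proper v : P v -> P (- v) -> v = 0.
Proof.
case: Dmo => _ _ _ + _ Pv PNv => /(_ 1%N isT) /seteqP[zero _].
suff /matrixP/(_ 0 0) : v%:M = 0 :> 'M_1 by rewrite !mxE.
apply: zero; split=> //; move: PNv; rewrite /P /=; congr D.
by apply/matrixP => i j; rewrite !mxE !ord1.
Qed.

End GroundCone.

Section OperatorSystem.
Context {R : realType} {V : starLmodType R} (D : forall n, set 'M[V]_n) (e : V).
Hypothesis Dsys : operator_system D e.
Implicit Types (u v : V).
Local Notation P := (ground_cone D).
Let PZ := groundZ Dsys.1.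
Let PD := groundD Dsys.1.

Lemma unit_sa : star e = e.
Proof. by case: Dsys => _ []. Qed.

Lemma ground_unit v : star v = v -> exists2 r : R, 0 < r & P (r%:C *: e - v).
Proof.
move=> vsa; case: Dsys => _ [_ /(_ 1%N isT v%:M)] [].
  by apply/matrixP => i j; rewrite !mxE !ord1.
move=> [r r0 Dr] _; exists r => //; move: Dr; rewrite /P /=; congr D.
by apply/matrixP => i j; rewrite !mxE !ord1.
Qed.

Lemma ground_archimedean v : star v = v ->
  (forall s : R, 0 < s -> P (s%:C *: e + v)) -> P v.
Proof.
move=> vsa Pv; case: Dsys => _ [_ /(_ 1%N isT v%:M)] [].
  by apply/matrixP => i j; rewrite !mxE !ord1.
move=> _; apply=> s s0; have := Pv s s0; rewrite /P /=; congr D.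
by apply/matrixP => i j; rewrite !mxE !ord1.
Qed.

Lemma ground_unit_pos : P e.
Proof.
have [r r0] := ground_unit (star0 V); rewrite subr0 => /PZ /=.
move=> /(_ r^-1); rewrite scalerA -rmorphM mulVf ?gt_eqF// scale1r.
by apply; rewrite invr_ge0 ltW.
Qed.

Lemma ground0 : P 0.
Proof. by rewrite -(scale0r e); apply: PZ => //; exact: ground_unit_pos. Qed.

Lemma ground_unit2 v : star v = v -> exists2 r : R, 0 < r &
  P (r%:C *: e - v) /\ P (r%:C *: e + v).
Proof.
move=> vsa; have [r r0 Pr] := ground_unit vsa.
have [|s s0] := @ground_unit (- v); first by rewrite starN vsa.
rewrite opprK => Ps; have grow (x y : R) w : x <= y ->
    P (x%:C *: e + w) -> P (y%:C *: e + w).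
  move=> xy Px; rewrite -(subrK x y) rmorphD scalerDl -addrA.
  by apply: PD Px; apply: PZ ground_unit_pos; rewrite subr_ge0.
exists (r + s); first exact: addr_gt0.
by split; [apply: grow Pr | apply: grow Ps]; rewrite (lerDl, lerDr) ltW.
Qed.

Definition hermitian_functional (f : V -> R[i]) :=
  forall v, f (star v) = Num.conj (f v).

Definition ground_positive (f : V -> R[i]) := forall v, P v -> 0 <= f v.

(* Adding i V_sa to the cone turns e into an order unit of the real space V. *)
Let Q : set V := [set v | P (v + star v)].

(** The Archimedean property yields [d > 0] with [w = d e + h] still outside the cone. Adjoining
    [- w] to [Q] does not capture [- e], so a functional normalised at [e] is nonnegative on [Q] and
    at [- w], whence [f h <= - d]. *)
Lemma real_functional_neg h : star h = h -> ~ P h ->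
  exists f : {linear realify V -> R^o},
    f h < 0 /\ forall v, Q v -> 0 <= f v.
Proof.
move=> hsa Ph.
have [d d0 Pd] : exists2 d : R, 0 < d & ~ P (d%:C *: e + h).
  apply: contrapT => nd; apply: Ph; apply: ground_archimedean => // s s0.
  by apply: contrapT => Ps; apply: nd; exists s.
have QD u v : Q u -> Q v -> Q (u + v).
  by rewrite /Q /= starD addrACA; exact: PD.
have QZ (r : R) v : 0 <= r -> Q v -> Q (r%:C *: v).
  by move=> r0; rewrite /Q /= starZr -scalerDr; exact: PZ.
have Q2 v : star v = v -> Q v -> P v.
  move=> vsa; rewrite /Q /= vsa -mulr2n -scaler_nat => /(PZ (r:=2^-1)).
  rewrite scalerA -(rmorph_nat (real_complex R)) -rmorphM mulVf ?pnatr_eq0//.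
  by rewrite scale1r; apply; rewrite invr_ge0.
have P2 v : P v -> Q v.
  by move=> Pv; rewrite /Q /= (ground_sa Dsys.1 Pv); exact: PD.
pose w := d%:C *: e + h.
have wsa : star w = w by rewrite starD starZr unit_sa hsa.
pose K : set (realify V) := [set v | exists2 t : R, 0 <= t & Q (v + t%:C *: w)].
have QK v : Q v -> K v.
  by move=> Qv; exists 0 => //; rewrite rmorph0 scale0r addr0.
have [f [fe fK]] : exists f : {linear realify V -> R^o},
    f e = 1 /\ forall v, K v -> 0 <= f v.
  apply: positive_functional.
  - split=> [u v [s s0 Qu] [t t0 Qv]|t u t0 [s s0 Qu]].
      exists (s + t); first exact: addr_ge0.
      by rewrite rmorphD scalerDl addrACA; exact: QD.
    exists (t * s); first exact: mulr_ge0.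
    by rewrite realifyZ rmorphM -scalerA -scalerDr; exact: QZ.
  - move=> [t t0 Qt]; have Pt : P (- e + t%:C *: w).
      by apply: Q2 => //; rewrite starD starN starZr wsa unit_sa.
    have Ptw : P (t%:C *: w).
      by rewrite -(addNKr e (_ *: w)); apply: PD => //; exact: ground_unit_pos.
    apply: Pd; move: t0; rewrite le_eqVlt => /predU1P[t0|t0]; last first.
      move: Ptw => /(PZ (r:=t^-1)); rewrite scalerA -rmorphM mulVf ?gt_eqF//.
      by rewrite scale1r; apply; rewrite invr_ge0 ltW.
    (* The case [t = 0]: properness gives [e = 0], and then the order unit property alone puts [h]
       into the cone. *)
    move: Pt; rewrite -t0 rmorph0 scale0r addr0 => PNe.
    have e0 := ground_proper Dsys.1 ground_unit_pos PNe.
    have [|r _] := @ground_unit (- h); first by rewrite starN hsa.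
    by rewrite opprK e0 !scaler0.
  - move=> v; have [|r r0 Pr] := @ground_unit (v + star v).
      by rewrite starD starK addrC.
    (* [r e - v] plus its star is [r e] plus [r e - (v + star v)], a sum of two elements of the
       cone. *)
    exists r => //; apply: QK; rewrite /Q /= starD starN realifyZ starZr unit_sa.
    rewrite addrACA -opprD -addrA [_ - _]addrC; apply: PD.
      by apply: PZ; [exact: ltW | exact: ground_unit_pos].
    by rewrite addrC.
exists f; split; last by move=> v /QK; exact: fK.
have : 0 <= f (- (w : realify V)).
  apply: fK; exists 1 => //; rewrite rmorph1 scale1r addNr.
  by rewrite /Q /= star0 addr0; exact: ground0.
rewrite raddfN oppr_ge0 => fw.
have : f w = d + f h by rewrite [LHS]linearP fe /= /GRing.scale /= mulr1.
move=> fwE; have {fw fwE} : d + f h <= 0 by rewrite -fwE.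
by lra.
Qed.

(** By properness a nonzero self-adjoint [h] has [h] or [- h] outside the cone, so some real
    functional is nonzero at [h]. Such a functional kills skew-adjoint elements, which makes its
    complexification hermitian. *)
Lemma functional_separates v : v != 0 -> exists f : {linear V -> R[i]^o},
  [/\ f v != 0, hermitian_functional f & ground_positive f].
Proof.
move=> v0.
have sep h : star h = h -> h != 0 -> exists f : {linear realify V -> R^o},
    f h != 0 /\ forall v, Q v -> 0 <= f v.
  move=> hsa h0; have [Ph|Ph] := pselect (P h); last first.
    by have [f [fh fQ]] := real_functional_neg hsa Ph; exists f; rewrite lt_eqF.
  have [||f [fh fQ]] := @real_functional_neg (- h); first by rewrite starN hsa.
    by move=> PNh; move: h0; rewrite (ground_proper Dsys.1 Ph PNh) eqxx.
  by exists f; split=> //; move: fh; rewrite raddfN oppr_lt0 => /gt_eqF/= ->.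
(* For skew-adjoint [x], both [x] and [- x] belong to [Q]. *)
have f0 (f : {linear realify V -> R^o}) (x : V) :
    (forall u, Q u -> 0 <= f u) -> x + star x = 0 -> f x = 0.
  move=> fQ xx; apply/eqP; rewrite eq_le -oppr_ge0 -raddfN /=.
  by rewrite !fQ // /Q /= ?starN -?opprD xx ?oppr0; exact: ground0.
have [f [fv fQ]] : exists f : {linear realify V -> R^o},
    (f v != 0 \/ f ('i *: v) != 0) /\ forall u, Q u -> 0 <= f u.
  (* A skew-adjoint [v] becomes self-adjoint after multiplication by ['i]; otherwise [f] is chosen
     nonzero at [v + star v], where its value is [2 f v]. *)
  have [vNsa|h0] := eqVneq (v + star v) 0.
    have [||f [fh fQ]] := sep ('i *: v).
    - by rewrite starZ conj_i scaleNr -(addr0_eq vNsa) scalerN opprK.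
    - by rewrite scaler_eq0 (negPf v0) orbF eq_complex /= negb_and oner_neq0 orbT.
    by exists f; split=> //; right.
  have [||f [fh fQ]] := sep (v + star v) => //; first by rewrite starD starK addrC.
  exists f; split=> //; left; apply: contra_neq fh => fv.
  by rewrite raddfD -(subrK v (star v)) raddfD /= fv f0 ?addr0 //
    starD starN starK addrA subrK subrr.
(* The usual complex-linear functional with real part [f]. *)
pose F (u : V) : R[i]^o := f u +i* (- f ('i *: u)).
have F_lin : linear F.
  move=> [x y] u w.
  have aE : (x +i* y) *: u = x%:C *: u + y%:C *: ('i *: u).
    by rewrite scalerA -scalerDl mulrC; congr (_ *: _); rewrite [LHS]complexE.
  have iaE : 'i *: ((x +i* y) *: u) = x%:C *: ('i *: u) + (- y)%:C *: u.
    rewrite !scalerA -scalerDl; congr (_ *: _); rewrite [_ +i* _]complexE /=.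
    by rewrite mulrDr mulrA -expr2 sqr_i mulN1r rmorphN mulrC.
  have fD (p q : R) (u1 u2 u3 : V) :
    f (p%:C *: u1 + q%:C *: u2 + u3) = p * f u1 + q * f u2 + f u3.
    rewrite -!realifyZ raddfD /= raddfD /=.
    by rewrite [X in X + _ + _]linearZ [X in _ + X + _]linearZ.
  rewrite /F scalerDr iaE aE !fD; apply/eqP; rewrite eq_complex /=.
  by apply/andP; split; apply/eqP; ring.
pose FL := GRing.isLinear.Build _ _ _ _ F F_lin.
pose FF : {linear V -> R[i]^o} := HB.pack F FL.
exists FF; split=> [|u|u Pu].
- by rewrite eq_complex /= oppr_eq0 negb_and; apply/orP.
- rewrite /= /F; apply/eqP; rewrite eq_complex /=.
  have fstar x : f (star x) = f x.
    rewrite -(subrK x (star x)) raddfD /= f0 ?add0r //.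
    by rewrite starD starN starK addrA subrK subrr.
  by rewrite -[f ('i *: _)]fstar starZ conj_i starK scaleNr raddfN fstar !eqxx.
- rewrite lecE /= (f0 f) // ?oppr0 ?eqxx /=; last first.
    by rewrite starZ conj_i (ground_sa Dsys.1 Pu) scaleNr subrr.
  by apply: fQ; rewrite /Q /= (ground_sa Dsys.1 Pu); exact: PD.
Qed.

End OperatorSystem.

(** * Tensor products *)

Section PureSums.
Context (C : comNzRingType) (S T W : lmodType C) (b : {bilinear S -> T -> W}).

Definition pure_sum : {pred W} :=
  [pred w | `[< exists r : seq (S * T), w = \sum_(p <- r) b p.1 p.2 >]].

Lemma pure_sum_closed : submod_closed pure_sum.
Proof.
split=> [|a u v /asboolP[r ->] /asboolP[r' ->]]; apply/asboolP.
  by exists [::]; rewrite big_nil.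
exists ([seq (a *: p.1, p.2) | p <- r] ++ r'); rewrite big_cat big_map /=.
by congr (_ + _); rewrite scaler_sumr; apply: eq_bigr => p _; rewrite linearZl_LR.
Qed.

HB.instance Definition _ := GRing.isSubmodClosed.Build C W pure_sum pure_sum_closed.

(** The span of the pure tensors as a module in its own right, so that it can serve as a target in
    the universal property. *)
Record pure_span := PureSpan { pure_val :> W; _ : pure_val \in pure_sum }.
HB.instance Definition _ := [isSub for pure_val].
HB.instance Definition _ := [Choice of pure_span by <:].
HB.instance Definition _ := [SubChoice_isSubLmodule of pure_span by <:].

Lemma mem_pure_sum s t : b s t \in pure_sum.
Proof. by apply/asboolP; exists [:: (s, t)]; rewrite big_seq1. Qed.

Definition pure s t : pure_span := PureSpan (mem_pure_sum s t).

Lemma pure_bilinear : bilinear_for *:%R *:%R pure.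
Proof.
split=> [t a u v|s a u v]; apply: val_inj; rewrite /=.
  by rewrite linearPl.
by rewrite linearPr.
Qed.

HB.instance Definition _ :=
  bilinear_isBilinear.Build C S T pure_span *:%R *:%R pure pure_bilinear.

End PureSums.

Section FunctionalProduct.
Context (C : comNzRingType) (S T : lmodType C).
Context (f : {linear S -> C^o}) (g : {linear T -> C^o}).

Definition functional_mul s t : C^o := f s * g t.

Lemma functional_mul_bilinear : bilinear_for *:%R *:%R functional_mul.
Proof.
split=> [t a u v|s a u v]; rewrite /functional_mul /= linearP /GRing.scale /=.
  by rewrite mulrDl mulrA.
by rewrite mulrDr mulrCA.
Qed.

HB.instance Definition _ :=
  bilinear_isBilinear.Build C S T C^o *:%R *:%R functional_mul functional_mul_bilinear.

End FunctionalProduct.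

Section TensorSeparation.
Context (C : fieldType) (S T : lmodType C).
Context (A : set {linear S -> C^o}) (B : set {linear T -> C^o}).
Hypothesis Asep : forall s, s != 0 -> exists2 f, A f & f s != 0.
Hypothesis Bsep : forall t, t != 0 -> exists2 g, B g & g t != 0.

(** Expanding [(s - k s *: s0) ⊗ t] over the terms of [r] collects the coefficients of [s0] into
    exactly [t0]. A linear relation among the second factors thus shortens a tensor sum by one
    term. *)
Lemma pure_sum_eliminate (U : lmodType C) (b : {bilinear S -> T -> U})
    (k : S -> C) s0 t0 (r : seq (S * T)) :
  t0 = - \sum_(p <- r) k p.1 *: p.2 ->
  \sum_(p <- [seq (p.1 - k p.1 *: s0, p.2) | p <- r]) b p.1 p.2 =
  \sum_(p <- (s0, t0) :: r) b p.1 p.2.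
Proof.
move=> ->; rewrite big_cons big_map /= linearNr linear_sumr addrC -sumrB.
by apply: eq_bigr => p _; rewrite linearBl linearZl_LR linearZr_LR.
Qed.

(** Induction on the number of terms, with no choice of bases. If [f s0] is nonzero, contracting the
    first factors by [f] gives a relation among the second factors, solvable for [t0]; the term
    [s0 ⊗ t0] can then be eliminated. *)
Lemma pure_sum_eq0 (U : lmodType C) (b : {bilinear S -> T -> U}) (r : seq (S * T)) :
  (forall f g, A f -> B g -> \sum_(p <- r) f p.1 * g p.2 = 0) ->
  \sum_(p <- r) b p.1 p.2 = 0.
Proof.
have [n] := ubnP (size r); elim: n r => // n IHn [|[s0 t0] r] /= rn fg0.
  by rewrite big_nil.
have [s00|/Asep[f Af fs0]] := eqVneq s0 0.
  rewrite big_cons /= s00 linear0l add0r; apply: IHn => // f g Af Bg.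
  by have := fg0 f g Af Bg; rewrite big_cons /= s00 linear0 mul0r add0r.
pose k s := f s / f s0.
have t0E : t0 = - \sum_(p <- r) k p.1 *: p.2.
  (* This vector vanishes because every functional in the separating family [B] kills it. *)
  have : \sum_(p <- (s0, t0) :: r) f p.1 *: p.2 = 0.
    apply/eqP; apply: contraT => /Bsep[g Bg]; rewrite linear_sum /=.
    under eq_bigr do rewrite linearZ /=.
    by rewrite (fg0 f g Af Bg) eqxx.
  rewrite big_cons /= => /eqP; rewrite addr_eq0 => /eqP.
  move=> /(congr1 (fun t => (f s0)^-1 *: t)).
  rewrite scalerA mulVf// scale1r => ->; rewrite scalerN scaler_sumr.
  by congr (- _); apply: eq_bigr => p _; rewrite scalerA mulrC.
rewrite -(pure_sum_eliminate b s0 t0E); apply: IHn; first by rewrite size_map.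
move=> f' g Af' Bg.
(* The same elimination, now for the scalar form [f' ⊗ g], carries the vanishing hypothesis over to
   the shorter sum. *)
by rewrite (pure_sum_eliminate (functional_mul f' g) s0 t0E); exact: fg0.
Qed.

End TensorSeparation.

Section TensorProduct.
Context (R : rcfType) (S T W : starLmodType R) (tens : {bilinear S -> T -> W}).
Hypothesis tensP : star_tensor_product tens.

(* By uniqueness in the universal property, id_W factors through the span. *)
Lemma tens_spanned w : exists r : seq (S * T), w = \sum_(p <- r) tens p.1 p.2.
Proof.
have [f fE] := tens_exists tensP (pure tens).
have /(_ w) : \val \o f =1 idfun.
  by apply: (tens_unique tensP) => s t /=; rewrite fE.
by move=> /= <-; have /asboolP := valP (f w).
Qed.

Lemma tens_separates (A : set {linear S -> R[i]^o}) (B : set {linear T -> R[i]^o}) w :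
  (forall s, s != 0 -> exists2 f, A f & f s != 0) ->
  (forall t, t != 0 -> exists2 g, B g & g t != 0) ->
  (forall f g (h : {linear W -> R[i]^o}), A f -> B g ->
    (forall s t, h (tens s t) = f s * g t) -> h w = 0) -> w = 0.
Proof.
move=> Asep Bsep; have [r ->] := tens_spanned w => hw0.
apply: (pure_sum_eq0 Asep Bsep) => f g Af Bg.
have [h hE] := tens_exists tensP (functional_mul f g).
rewrite -[RHS](hw0 f g h Af Bg hE) linear_sum.
by apply: eq_bigr => p _; rewrite hE.
Qed.

End TensorProduct.

(** * Positive semidefinite matrices *)

Section MapMatrices.
Context (C : comNzRingType) (V : lmodType C) (h : {linear V -> C^o}).

Lemma map_lactmx m n p (A : 'M[C]_(m, n)) (X : 'M[V]_(n, p)) :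
  map_mx h (lactmx A X) = A *m map_mx h X :> 'M[C]_(m, p).
Proof.
apply/matrixP => i j; rewrite !mxE linear_sum; apply: eq_bigr => k _.
by rewrite !mxE linearZ.
Qed.

Lemma map_ractmx m n p (X : 'M[V]_(m, n)) (A : 'M[C]_(n, p)) :
  map_mx h (ractmx X A) = map_mx h X *m A :> 'M[C]_(m, p).
Proof.
apply/matrixP => i j; rewrite !mxE linear_sum; apply: eq_bigr => k _.
by rewrite !mxE linearZ mulrC.
Qed.

Lemma map_tens_lambda (V1 V2 : lmodType C) k l
    (lam : {bilinear 'M[C]_k -> 'M[C]_k -> 'M[C]_l}) (b : V1 -> V2 -> V)
    (f : V1 -> C) (g : V2 -> C) (X : 'M[V1]_k) (Y : 'M[V2]_k) :
  (forall s t, h (b s t) = f s * g t) ->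
  map_mx h (tens_lambda lam b X Y) = lam (map_mx f X) (map_mx g Y).
Proof.
move=> hE; rewrite (matrix_sum_delta (map_mx f X)) (matrix_sum_delta (map_mx g Y)).
apply/matrixP => i j; rewrite mxE /tens_lambda.
rewrite linear_sumlz !summxE linear_sum; apply: eq_bigr => i1 _.
rewrite linear_sumlz !summxE linear_sum; apply: eq_bigr => j1 _.
rewrite linear_sumr !summxE linear_sum; apply: eq_bigr => i2 _.
rewrite linear_sumr !summxE linear_sum; apply: eq_bigr => j2 _.
by rewrite linearZl_LR linearZr_LR !mxE linearZ /= hE /GRing.scale /= mulrC -mulrA.
Qed.

End MapMatrices.

Section PositiveSemidefinite.
Context {R : realType}.
Local Notation C := R[i].

Lemma adjmxM m n p (A : 'M[C]_(m, n)) (B : 'M[C]_(n, p)) :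
  (A *m B) ^t* = B ^t* *m A ^t*.
Proof. by rewrite trmx_mul map_mxM. Qed.

Lemma adjmxK m n (A : 'M[C]_(m, n)) : A ^t* ^t* = A.
Proof. by apply/matrixP => i j; rewrite !mxE conjCK. Qed.

Lemma psdmx_cong m n (A : 'M[C]_(m, n)) (M : 'M[C]_n) :
  psdmx M -> psdmx (A *m M *m A ^t*).
Proof.
move=> [Msa Mge0]; split; first by rewrite !adjmxM adjmxK Msa mulmxA.
by move=> v; have := Mge0 (A ^t* *m v); rewrite adjmxM adjmxK !mulmxA.
Qed.

(** The quadratic form vanishes identically. Polarising makes the sesquilinear form [B] skew;
    replacing [v] by ['i *: v] makes it symmetric as well, so [B] is zero, and its values at basis
    vectors are the entries of [M]. *)
Lemma psdmx_anti n (M : 'M[C]_n) : psdmx M -> psdmx (- M) -> M = 0.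
Proof.
move=> [_ Mge0] [_ Mle0].
have M0 (v : 'cV[C]_n) : v ^t* *m M *m v = 0.
  apply/matrixP => i j; rewrite !ord1 [RHS]mxE; apply/eqP.
  by have := Mle0 v; rewrite mulmxN mulNmx mxE oppr_ge0 => le0; rewrite eq_le le0 Mge0.
pose B u v : 'M[C]_1 := u ^t* *m M *m v.
have BZ a u v : B u (a *: v) = a *: B u v by rewrite /B -scalemxAr.
have BZl a u v : B (a *: u) v = Num.conj a *: B u v.
  rewrite /B; have -> : (a *: u) ^t* = Num.conj a *: u ^t*.
    by apply/matrixP => i j; rewrite !mxE rmorphM.
  by rewrite -!scalemxAl.
have Bskew u v : B u v = - B v u.
  have := M0 (u + v); have -> : (u + v) ^t* = u ^t* + v ^t*.
    by apply/matrixP => i j; rewrite !mxE rmorphD.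
  rewrite !mulmxDl !mulmxDr !M0 add0r addr0.
  by move/eqP; rewrite addr_eq0 => /eqP.
have B0 u v : B u v = 0.
  have := Bskew u ('i *: v); rewrite BZ BZl conj_i scaleNr opprK => /eqP.
  rewrite -subr_eq0 -scalerBr scaler_eq0 => /orP[|].
    by rewrite eq_complex /= oner_eq0 andbF.
  by rewrite [B v u]Bskew opprK -mulr2n -scaler_nat scaler_eq0 pnatr_eq0 => /eqP.
apply/matrixP => i j; have /matrixP/(_ 0 0) := B0 (delta_mx i 0) (delta_mx j 0).
rewrite !mxE => <-; rewrite (bigD1 j) //= big1 => [|k kj]; last first.
  by rewrite [delta_mx _ _ _ _]mxE (negPf kj) mulr0.
rewrite addr0 !mxE !eqxx mulr1 (bigD1 i) //= big1 => [|k ki]; last first.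
  by rewrite !mxE (negPf ki) rmorph0 mul0r.
by rewrite addr0 !mxE !eqxx rmorph1 mul1r.
Qed.

Lemma psdmx_castmx m n (e : m = n) (A : 'M[C]_m) :
  psdmx (castmx (e, e) A) <-> psdmx A.
Proof. by case: _ / e; rewrite castmx_id. Qed.

(** With blocks of size 1 flattening does nothing beyond the cast along [r * 1 = r]; this is what
    lets (O3) speak about plain complex matrices. *)
Lemma flatmx1E r (X : 'M['M[C]_1]_r) :
  flatmx X = castmx (esym (muln1 r), esym (muln1 r)) (map_mx (fun a : 'M[C]_1 => a 0 0) X).
Proof.
have unindex1 (a : 'I_(r * 1)) : cast_ord (esym (esym (muln1 r))) a = (mxtens_unindex a).1.
  by apply: val_inj; rewrite /= divn1.
apply/matrixP => a b; rewrite castmxE !unindex1 mxE /flatmx.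
rewrite summxE (bigD1 (mxtens_unindex a).1) //= [X in _ + X]big1 => [|i ia]; last first.
  by rewrite summxE big1 // => j _; rewrite !mxE eq_sym (negPf ia) mul0r.
rewrite addr0 summxE (bigD1 (mxtens_unindex b).1) //= [X in _ + X]big1 => [|j jb]; last first.
  by rewrite !mxE [_ == j]eq_sym (negPf jb) andbF mul0r.
by rewrite addr0 !mxE !eqxx mul1r !ord1.
Qed.

Lemma lambda_psdmx (tau : nat -> nat)
    (lam : forall k, {bilinear 'M[C]_k -> 'M[C]_k -> 'M[C]_(tau k)}) r (M N : 'M[C]_r) :
  condO3 lam -> (0 < r)%N -> psdmx M -> psdmx N -> psdmx (lam r M N).
Proof.
move=> O3 r0 Mpsd Npsd.
have scalarK (A : 'M[C]_r) : map_mx (fun a : 'M_1 => a 0 0) (map_mx scalar_mx A) = A.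
  by apply/matrixP => i j; rewrite !mxE.
have flat_psd (A : 'M[C]_r) : psdmx A -> psdmx (flatmx (map_mx (@scalar_mx C 1) A)).
  by move=> Apsd; rewrite flatmx1E scalarK; apply/psdmx_castmx.
have := O3 r 1%N 1%N r0 isT isT _ _ (flat_psd M Mpsd) (flat_psd N Npsd).
rewrite [flatmx _]flatmx1E => /psdmx_castmx.
(* Reading off the single entry is linear and sends the Kronecker product of 1 by 1 matrices to the
   product of scalars, so [map_tens_lambda] applies. *)
pose entry (a : 'M[C]_1) : C^o := a 0 0.
have entry_lin : linear entry by move=> a u v; rewrite /entry !mxE.
pose h : {linear 'M[C]_1 -> C^o} := HB.pack entry (GRing.isLinear.Build _ _ _ _ entry entry_lin).
rewrite -/entry (@map_tens_lambda _ _ h _ _ _ _ _ _ entry entry) ?scalarK //.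
by move=> s t; rewrite /= /entry mxE !ord1.
Qed.

End PositiveSemidefinite.

(** The quadratic form of the image at [v] is [f] applied to the compression of [X] by [v], which
    lies in the ground cone. Hence positivity on the first level gives it on every level. *)
Lemma functional_psdmx (R : realType) (V : starLmodType R) (D : forall n, set 'M[V]_n) e
    (f : {linear V -> R[i]^o}) n (X : 'M[V]_n) :
  operator_system D e -> hermitian_functional f -> ground_positive D f ->
  (0 < n)%N -> D n X -> psdmx (map_mx f X : 'M[R[i]]_n).
Proof.
move=> [Dmo _] fh fpos n0 DX; split=> [|v].
  apply/matrixP => i j; rewrite !mxE -fh.
  by have /matrixP/(_ i j) := mo_sa Dmo n0 DX; rewrite mxE => ->.
rewrite -map_lactmx -map_ractmx mxE; apply: fpos.
by rewrite /ground_cone /= scalar_mx1E; exact: mo_compat.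
Qed.

(** * The cones of the λ-tensor product *)

Lemma bilinear_mx_ext (C : comNzRingType) (U : lmodType C) m n p q
    (F G : 'M[C]_(m, n) -> 'M[C]_(p, q) -> U) :
  bilinear_for *:%R *:%R F -> bilinear_for *:%R *:%R G ->
  (forall i1 j1 i2 j2, F (delta_mx i1 j1) (delta_mx i2 j2) =
                       G (delta_mx i1 j1) (delta_mx i2 j2)) ->
  forall A B, F A B = G A B.
Proof.
move=> Fbil Gbil FG A B.
pose f : {bilinear 'M[C]_(m, n) -> 'M[C]_(p, q) -> U} :=
  HB.pack F (bilinear_isBilinear.Build _ _ _ _ _ _ F Fbil).
pose g : {bilinear 'M[C]_(m, n) -> 'M[C]_(p, q) -> U} :=
  HB.pack G (bilinear_isBilinear.Build _ _ _ _ _ _ G Gbil).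
rewrite -[F]/(f : _ -> _ -> _) -[G]/(g : _ -> _ -> _).
rewrite (matrix_sum_delta A) (matrix_sum_delta B).
rewrite !linear_sumlz; apply: eq_bigr => i1 _.
rewrite !linear_sumlz; apply: eq_bigr => j1 _.
rewrite !linear_sumr; apply: eq_bigr => i2 _.
rewrite !linear_sumr; apply: eq_bigr => j2 _.
by rewrite !linearZl_LR !linearZr_LR /= FG.
Qed.

Lemma munit_delta (C : pzRingType) k (i j : 'I_k) : munit C k i.+1 j.+1 = delta_mx i j.
Proof. by apply/matrixP => a b; rewrite !mxE !eqSS. Qed.

(** The index 0 is the value of [i - r] under truncated subtraction when [i <= r]; an out-of-range
    row index already annihilates the unit. *)
Lemma munit_out (C : pzRingType) k i j : (k < i)%N || (i == 0)%N -> munit C k i j = 0.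
Proof.
move=> ik; apply/matrixP => a b; rewrite !mxE; case: eqP => //= ai.
by move: ik; rewrite -ai ltnNge ltn_ord.
Qed.

Lemma munit_ul (C : pzRingType) r s (i j : 'I_r) :
  munit C (r + s) i.+1 j.+1 = block_mx (delta_mx i j) 0 0 0.
Proof.
apply/matrixP => a b; rewrite !mxE.
by case: splitP => a' ->; rewrite !mxE; case: splitP => b' ->; rewrite !mxE ?eqSS //;
  rewrite ?(gtn_eqF (leq_trans (ltn_ord _) (leq_addr _ _))) ?andbF.
Qed.

Lemma munit_dr (C : pzRingType) r s (i j : 'I_s) :
  munit C (r + s) (r + i).+1 (r + j).+1 = block_mx 0 0 0 (delta_mx i j).
Proof.
apply/matrixP => a b; rewrite !mxE.
by case: splitP => a' ->; rewrite !mxE; case: splitP => b' ->; rewrite !mxE ?eqSS ?eqn_add2l //;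
  rewrite ?(ltn_eqF (leq_trans (ltn_ord _) (leq_addr _ _))) ?andbF.
Qed.

Section BlockActions.
Context {C : pzRingType} {V : lmodType C}.

Lemma lactmx_col m1 m2 n p (A : 'M[C]_(m1, n)) (B : 'M[C]_(m2, n)) (X : 'M[V]_(n, p)) :
  lactmx (col_mx A B) X = col_mx (lactmx A X) (lactmx B X).
Proof.
apply/matrixP => i j; rewrite !mxE; case: split_ordP => k ->; rewrite mxE;
  by apply: eq_bigr => l _; rewrite (col_mxEu, col_mxEd).
Qed.

Lemma ractmx_row m n p1 p2 (X : 'M[V]_(m, n)) (A : 'M[C]_(n, p1)) (B : 'M[C]_(n, p2)) :
  ractmx X (row_mx A B) = row_mx (ractmx X A) (ractmx X B).
Proof.
apply/matrixP => i j; rewrite !mxE; case: split_ordP => k ->; rewrite mxE;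
  by apply: eq_bigr => l _; rewrite (row_mxEl, row_mxEr).
Qed.

Lemma lact1mx m n (X : 'M[V]_(m, n)) : lactmx 1%:M X = X.
Proof.
apply/matrixP => i j; rewrite mxE (bigD1 i) //= big1 => [|k ki].
  by rewrite mxE eqxx scale1r addr0.
by rewrite mxE eq_sym (negPf ki) scale0r.
Qed.

Lemma ractmx1 m n (X : 'M[V]_(m, n)) : ractmx X 1%:M = X.
Proof.
apply/matrixP => i j; rewrite mxE (bigD1 j) //= big1 => [|k kj].
  by rewrite mxE eqxx scale1r addr0.
by rewrite mxE (negPf kj) scale0r.
Qed.

Lemma lact0mx m n p (X : 'M[V]_(n, p)) : lactmx (0 : 'M[C]_(m, n)) X = 0.
Proof. by apply/matrixP => i j; rewrite !mxE big1 // => k _; rewrite mxE scale0r. Qed.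

Lemma ractmx0 m n p (X : 'M[V]_(m, n)) : ractmx X (0 : 'M[C]_(n, p)) = 0.
Proof. by apply/matrixP => i j; rewrite !mxE big1 // => k _; rewrite mxE scale0r. Qed.

End BlockActions.

(** * (E2) for arbitrary block-diagonal arguments *)

Section DirectSum.
Context {R : realType} (tau : nat -> nat).
Context (lam : forall k, {bilinear 'M[R[i]]_k -> 'M[R[i]]_k -> 'M[R[i]]_(tau k)}).
Local Notation C := R[i].

(** Both sides are bilinear, so (E2) on matrix units is enough. Splitting each argument into its two
    diagonal blocks gives four products, each compared on units through [F]. *)
Lemma lambda_direct_sum r s (P : 'M[C]_(tau r + tau s, tau (r + s)))
    (A1 A2 : 'M[C]_r) (B1 B2 : 'M[C]_s) :
  E2_equations lam P ->
  P *m lam (r + s) (block_mx A1 0 0 B1) (block_mx A2 0 0 B2) *m P ^t* =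
  block_mx (lam r A1 A2) 0 0 (lam s B1 B2).
Proof.
move=> PE.
pose ul (A : 'M[C]_r) : 'M[C]_(r + s) := block_mx A 0 0 0.
pose dr (B : 'M[C]_s) : 'M[C]_(r + s) := block_mx 0 0 0 B.
have ulP : linear ul.
  by move=> a u v; rewrite /ul scale_block_mx add_block_mx !scaler0 !addr0.
have drP : linear dr.
  by move=> a u v; rewrite /dr scale_block_mx add_block_mx !scaler0 !addr0.
pose F m n (L1 : 'M[C]_m -> 'M[C]_(r + s)) (L2 : 'M[C]_n -> 'M[C]_(r + s)) A B :=
  P *m lam (r + s) (L1 A) (L2 B) *m P ^t*.
have F_bil m n (L1 : 'M[C]_m -> _) (L2 : 'M[C]_n -> _) :
    linear L1 -> linear L2 -> bilinear_for *:%R *:%R (F m n L1 L2).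
  move=> L1P L2P; split=> [y a u v|x a u v]; rewrite /F.
    by rewrite L1P linearPl mulmxDr -scalemxAr mulmxDl -scalemxAl.
  by rewrite L2P linearPr mulmxDr -scalemxAr mulmxDl -scalemxAl.
have ul_sq (i j : 'I_r) b : in_sq 0 r (i.+1, j.+1) || b by rewrite /in_sq /= !ltn_ord.
have dr_sq (i j : 'I_s) b : b || in_sq r (r + s) ((r + i).+1, (r + j).+1).
  by rewrite /in_sq /= !ltnS !leq_addr !ltn_add2l !ltn_ord orbT.
have ul_out (i j : 'I_r) : munit C s (i.+1 - r) (j.+1 - r) = 0.
  by apply: munit_out; rewrite subn_eq0 ltn_ord orbT.
have dr_out (i j : 'I_s) : munit C r (r + i).+1 (r + j).+1 = 0.
  by apply: munit_out; rewrite ltnS leq_addr.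
have dr_in (i j : 'I_s) : munit C s ((r + i).+1 - r) ((r + j).+1 - r) = delta_mx i j.
  by rewrite -!addnS !addKn munit_delta.
have ulul A B : F _ _ ul ul A B = block_mx (lam r A B) 0 0 0.
  apply: (bilinear_mx_ext (G := fun A B => block_mx (lam r A B) 0 0 0)); first exact: F_bil.
    by split=> [y a u v|x a u v]; rewrite /= (linearPl, linearPr) scale_block_mx
      add_block_mx !scaler0 !addr0.
  move=> i1 j1 i2 j2; rewrite /F /ul -!munit_ul PE // !munit_delta !ul_out.
  by rewrite linear0l.
have drdr A B : F _ _ dr dr A B = block_mx 0 0 0 (lam s A B).
  apply: (bilinear_mx_ext (G := fun A B => block_mx 0 0 0 (lam s A B))); first exact: F_bil.
    by split=> [y a u v|x a u v]; rewrite /= (linearPl, linearPr) scale_block_mx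
      add_block_mx !scaler0 !addr0.
  move=> i1 j1 i2 j2; rewrite /F /dr -!munit_dr PE // !dr_in !dr_out.
  by rewrite linear0l.
have zero_bil m n : bilinear_for *:%R *:%R (fun (_ : 'M[C]_m) (_ : 'M[C]_n) =>
    0 : 'M[C]_(tau r + tau s)).
  by split=> [y a u v|x a u v]; rewrite /= scaler0 addr0.
(* Mixed products vanish: in each diagonal corner of (E2) one of the two units is out of range. *)
have uldr A B : F _ _ ul dr A B = 0.
  apply: (bilinear_mx_ext (G := fun _ _ => 0)); [exact: F_bil|exact: zero_bil|].
  move=> i1 j1 i2 j2; rewrite /F /ul /dr -munit_ul -munit_dr PE // dr_out ul_out.
  by rewrite linear0l linear0r -block_mx0.
have drul A B : F _ _ dr ul A B = 0.
  apply: (bilinear_mx_ext (G := fun _ _ => 0)); [exact: F_bil|exact: zero_bil|].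
  move=> i1 j1 i2 j2; rewrite /F /ul /dr -munit_ul -munit_dr PE // dr_out ul_out.
  by rewrite linear0l linear0r -block_mx0.
have split_diag A B : block_mx A 0 0 B = ul A + dr B.
  by rewrite add_block_mx !addr0 add0r.
have -> : lam (r + s) (block_mx A1 0 0 B1) (block_mx A2 0 0 B2) =
    lam (r + s) (ul A1) (ul A2) + lam (r + s) (ul A1) (dr B2) +
    (lam (r + s) (dr B1) (ul A2) + lam (r + s) (dr B1) (dr B2)).
  by rewrite !split_diag linearDl !linearDr.
rewrite !mulmxDr !mulmxDl.
move: (ulul A1 A2) (uldr A1 B2) (drul B1 A2) (drdr B1 B2); rewrite /F => -> -> -> ->.
by rewrite addr0 add0r add_block_mx !addr0 add0r.
Qed.

End DirectSum.

(** * The cones form a matrix ordering *)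

Section Cone.
Context {R : realType} {S T W : starLmodType R} (tens : {bilinear S -> T -> W}).
Context (PS : forall n : nat, set 'M[S]_n) (PT : forall n : nat, set 'M[T]_n).
Context (tau : nat -> nat).
Context (lam : forall k, {bilinear 'M[R[i]]_k -> 'M[R[i]]_k -> 'M[R[i]]_(tau k)}).
Hypothesis tensP : star_tensor_product tens.
Context (oneS : S) (oneT : T).
Hypothesis hS : operator_system PS oneS.
Hypothesis hT : operator_system PT oneT.
Local Notation C := R[i].
Local Notation K := (lambda_cone lam tens PS PT).

Definition product_functional (h : {linear W -> C^o}) f g :=
  [/\ hermitian_functional f, ground_positive PS f,
      hermitian_functional g, ground_positive PT g &
      forall s t, h (tens s t) = f s * g t].

Lemma tens_eq (v w : W) :
  (forall h (f : {linear S -> C^o}) (g : {linear T -> C^o}),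
    product_functional h f g -> h v = h w) -> v = w.
Proof.
move=> vw; apply/eqP; rewrite -subr_eq0; apply/eqP.
pose A := [set f : {linear S -> C^o} | hermitian_functional f /\ ground_positive PS f].
pose B := [set g : {linear T -> C^o} | hermitian_functional g /\ ground_positive PT g].
apply: (tens_separates tensP (A := A) (B := B)) => [s s0|t t0|f g h [? ?] [? ?] hE].
- by have [f [f0 ? ?]] := functional_separates hS s0; exists f.
- by have [f [f0 ? ?]] := functional_separates hT t0; exists f.
by rewrite linearB /= (vw h f g) ?subrr.
Qed.

Lemma mx_tens_eq m n (X Y : 'M[W]_(m, n)) :
  (forall h (f : {linear S -> C^o}) (g : {linear T -> C^o}),
    product_functional h f g -> map_mx h X = map_mx h Y) -> X = Y.
Proof.
move=> XY; apply/matrixP => i j; apply: tens_eq => h f g hfg.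
by have /matrixP/(_ i j) := XY h f g hfg; rewrite !mxE.
Qed.

Lemma product_functional_star h (f : {linear S -> C^o}) (g : {linear T -> C^o}) w :
  product_functional h f g -> h (star w) = Num.conj (h w).
Proof.
move=> [fh _ gh _ hE]; have [r ->] := tens_spanned tensP w.
rewrite star_sum !linear_sum rmorph_sum; apply: eq_bigr => p _ /=.
by rewrite (star_tens tensP) !hE fh gh rmorphM.
Qed.

Lemma map_congmx_lambda h (f : {linear S -> C^o}) (g : {linear T -> C^o})
    n j (A : 'M[C]_(n, tau j)) s t :
  product_functional h f g ->
  map_mx h (congmx A (tens_lambda (lam j) tens s t)) =
  A *m lam j (map_mx f s) (map_mx g t) *m A ^t* :> 'M[C]_n.
Proof.
move=> [_ _ _ _ hE].
by rewrite /congmx map_ractmx map_lactmx (map_tens_lambda _ _ _ hE).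
Qed.

Lemma lambda_cone_psdmx h (f : {linear S -> C^o}) (g : {linear T -> C^o}) n (X : 'M[W]_n) :
  condO3 lam -> product_functional h f g -> K X -> psdmx (map_mx h X : 'M[C]_n).
Proof.
move=> O3 hfg [j [s [t [A [j0 Ps Pt ->]]]]]; rewrite (map_congmx_lambda _ _ _ hfg).
case: hfg => fh fp gh gp _.
apply: psdmx_cong; apply: lambda_psdmx => //.
- exact: functional_psdmx hS _ _ _ _.
- exact: functional_psdmx hT _ _ _ _.
Qed.

Lemma lambda_cone0 n : K (0 : 'M[W]_n).
Proof.
(* The coefficient matrix 0 already kills the product; [s] and [t] only have to lie in their
   cones. *)
exists 1%N, 0%:M, 0%:M, 0; split=> //; first exact: (ground0 hS).
  exact: (ground0 hT).
apply: mx_tens_eq => h f g hfg; rewrite (map_congmx_lambda _ _ _ hfg) !mul0mx.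
by apply/matrixP => i k; rewrite !mxE linear0.
Qed.

(** The direct sum is the sum of two compressions, of [X] by the block row [(1 0)] and of [Y] by
    [(0 1)]. *)
Lemma direct_sum_cone (V : starLmodType R) (D : forall n, set 'M[V]_n) r s
    (X : 'M[V]_r) (Y : 'M[V]_s) :
  matrix_ordering D -> (0 < r)%N -> (0 < s)%N -> D r X -> D s Y ->
  D (r + s)%N (block_mx X 0 0 Y).
Proof.
move=> Dmo r0 s0 DX DY.
have rs0 : (0 < r + s)%N by rewrite addn_gt0 r0.
have -> : block_mx X 0 0 Y =
    ractmx (lactmx ((row_mx 1%:M 0 : 'M[C]_(r, r + s)) ^t*) X) (row_mx 1%:M 0) +
    ractmx (lactmx ((row_mx 0 1%:M : 'M[C]_(s, r + s)) ^t*) Y) (row_mx 0 1%:M).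
  rewrite !tr_row_mx !map_col_mx !trmx1 !trmx0 !map_mx1 !map_mx0.
  rewrite !lactmx_col !ractmx_row !lact1mx !lact0mx !ractmx1 !ractmx0.
  by rewrite block_mxEh add_row_mx addr0 add0r.
by apply: (mo_add Dmo) => //; exact: (mo_compat Dmo).
Qed.

Lemma lambda_cone_add n (X Y : 'M[W]_n) :
  condE2 lam -> K X -> K Y -> K (X + Y).
Proof.
move=> E2 [r [s [t [A [r0 Ps Pt ->]]]]] [r' [s' [t' [A' [r'0 Ps' Pt' ->]]]]].
have [P [_ PE]] := E2 r r' r0 r'0.
(* [P] compresses the product of the direct sums to the block diagonal of the two products, and the
   row [A A'] then adds up their congruences. *)
exists (r + r')%N, (block_mx s 0 0 s'), (block_mx t 0 0 t'), (row_mx A A' *m P).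
split; first by rewrite addn_gt0 r0.
- exact: direct_sum_cone hS.1 _ _ _ _.
- exact: direct_sum_cone hT.1 _ _ _ _.
apply: mx_tens_eq => h f g hfg.
rewrite raddfD /= !(map_congmx_lambda _ _ _ hfg) !map_block_mx !map_mx0.
rewrite adjmxM !mulmxA -(mulmxA (row_mx _ _)) -(mulmxA (row_mx _ _)).
rewrite lambda_direct_sum // tr_row_mx map_col_mx mul_row_block mul_row_col.
by rewrite !mulmx0 addr0 add0r.
Qed.

Lemma lambda_cone_scale n (r : R) (X : 'M[W]_n) :
  0 <= r -> K X -> K (map_mx (fun v => r%:C *: v) X).
Proof.
move=> r0 [j [s [t [A [j0 Ps Pt ->]]]]].
(* By bilinearity it is enough to scale one factor. *)
exists j, (map_mx (fun v => r%:C *: v) s), t, A; split=> //; first exact: (mo_scale hS.1).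
apply: mx_tens_eq => h f g hfg.
have mapZ (V : lmodType C) (l : {linear V -> C^o}) k (M : 'M[V]_k) :
    map_mx l (map_mx (fun v => r%:C *: v) M) = r%:C *: (map_mx l M : 'M[C]_k).
  by apply/matrixP => a b; rewrite !mxE linearZ.
rewrite (map_congmx_lambda _ _ _ hfg) !mapZ (map_congmx_lambda _ _ _ hfg).
by rewrite linearZl_LR -scalemxAr -scalemxAl.
Qed.

Lemma lambda_cone_compat n k (A : 'M[C]_(n, k)) (X : 'M[W]_n) :
  K X -> K (ractmx (lactmx (A ^t*) X) A).
Proof.
move=> [j [s [t [B [j0 Ps Pt ->]]]]]; exists j, s, t, (A ^t* *m B); split=> //.
apply: mx_tens_eq => h f g hfg.
rewrite map_ractmx map_lactmx !(map_congmx_lambda _ _ _ hfg).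
by rewrite adjmxM adjmxK !mulmxA.
Qed.

Lemma lambda_cone_matrix_ordering :
  condE2 lam -> condO3 lam -> matrix_ordering K.
Proof.
move=> E2 O3; split=> [n _ X KX|n _ X Y|n _ r X|n _|n k _ _ A X].
- apply: mx_tens_eq => h f g hfg; rewrite -[RHS](lambda_cone_psdmx O3 hfg KX).1.
  by apply/matrixP => a b; rewrite !mxE (product_functional_star _ hfg).
- exact: lambda_cone_add.
- exact: lambda_cone_scale.
- apply/seteqP; split=> [X [KX KNX]|X ->]; last first.
    by split; rewrite /= ?oppr0; exact: lambda_cone0.
  apply: mx_tens_eq => h f g hfg.
  have -> : map_mx h (0 : 'M[W]_n) = 0.
    by apply/matrixP => a b; rewrite !mxE linear0.
  apply: psdmx_anti; first exact: lambda_cone_psdmx hfg KX.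
  have -> : - (map_mx h X : 'M[C]_n) = map_mx h (- X).
    by apply/matrixP => a b; rewrite !mxE linearN.
  exact: lambda_cone_psdmx hfg KNX.
- exact: lambda_cone_compat.
Qed.

(** * The order unit *)

Hypothesis lam11 : lam 1%N 1%:M 1%:M = 1%:M.
Hypothesis tau1 : tau 1%N = 1%N.
Hypothesis Kmo : matrix_ordering K.
Local Notation G := (ground_cone K).
Local Notation e := (tens oneS oneT).

Lemma tens_ground s t : ground_cone PS s -> ground_cone PT t -> G (tens s t).
Proof.
(* The matrix [const_mx 1] is the scalar 1 of size 1 by [tau 1]; it is written this way because
   [tau 1 = 1] is an equation and not a conversion. *)
move=> Ps Pt; exists 1%N, s%:M, t%:M, (const_mx 1); split=> //.
apply: mx_tens_eq => h f g hfg; rewrite (map_congmx_lambda _ _ _ hfg).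
case: hfg => _ _ _ _ hE.
have mapS (V : lmodType C) (l : {linear V -> C^o}) (v : V) :
    map_mx l (v%:M : 'M_1) = l v *: (1%:M : 'M[C]_1).
  by apply/matrixP => i j; rewrite !ord1 !mxE mulr1.
rewrite !mapS hE [lam _ _ _]linearZl_LR [lam _ _ _]linearZr_LR lam11 -!scalemxAr mulmx1 -!scalemxAl.
rewrite scalerA; congr (_ *: _); apply/matrixP => i j; rewrite !ord1 !mxE.
under eq_bigr do rewrite !mxE rmorph1 mulr1.
by rewrite sumr_const card_ord tau1.
Qed.

Lemma tens_sa_bounded a c : star a = a -> star c = c ->
  exists2 r : R, 0 < r & G (r%:C *: e - 2%:C *: tens a c).
Proof.
move=> asa csa; have [k k0 [ka ka']] := ground_unit2 hS asa.
have [l l0 [lc lc']] := ground_unit2 hT csa.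
(* Here [k] bounds both [a] and [- a], and [l] both [c] and [- c], so all four factors of the
   identity are positive. Its factor 2 is kept, since real parts of tensors arise doubled. *)
exists (2 * (k * l)); first by rewrite !mulr_gt0.
have := groundD Kmo (tens_ground ka lc') (tens_ground ka' lc).
congr G; rewrite linearBl linearDl !linearDr !linearNr !linearZl_LR !linearZr_LR.
have cancel (x y z w : W) :
    x + y - (z + w) + (x - y + (z - w)) = x *+ 2 - w *+ 2.
  by rewrite opprD addrACA [x + y + _]addrACA subrr addr0 [- z - w + _]addrACA addNr
    add0r -opprD -!mulr2n.
have two : 2%:C = 2%:R :> C by rewrite rmorph_nat.
by rewrite cancel !rmorphM /= two -!scalerA !scaler_nat.
Qed.

(** For [s = a + 'i b] and [t = c + 'i d] the cross terms cancel against the star, leaving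
    [2 a ⊗ c - 2 b ⊗ d]; the minus sign is absorbed by bounding the pair [- b], [d]. *)
Lemma real_part_bounded s t :
  exists2 r : R, 0 < r & G (r%:C *: e - (tens s t + star (tens s t))).
Proof.
have [a [b [asa bsa ->]]] := cartesian_decomposition s.
have [c [d [csa dsa ->]]] := cartesian_decomposition t.
have [r r0 Gr] := tens_sa_bounded asa csa.
have [|r' r'0 Gr'] := @tens_sa_bounded (- b) d _ dsa; first by rewrite starN bsa.
exists (r + r'); first exact: addr_gt0.
have := groundD Kmo Gr Gr'; congr G.
rewrite addrACA -scalerDl -rmorphD -opprD; congr (_ - _).
rewrite (star_tens tensP) !starD !starZ asa bsa csa dsa !conj_i.
have cancel (p u v q : W) :
    p + u + (v - q) + (p - u + (- v - q)) = p *+ 2 - q *+ 2.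
  by rewrite addrACA [p + u + _]addrACA subrr addr0 [v - q + _]addrACA subrr add0r
    -opprD -!mulr2n.
have ii : 'i * 'i = -1 :> C by rewrite -expr2 sqr_i.
rewrite !linearDl !linearDr !linearZl_LR !linearZr_LR linearNl !scaleNr !scalerN.
rewrite !opprK !scalerA ii scaleN1r cancel.
have two : 2%:C = 2%:R :> C by rewrite rmorph_nat.
by rewrite two !scaler_nat.
Qed.

(** A self-adjoint tensor need not be a sum of self-adjoint pure tensors. The bound is therefore
    proved for [w + star w] with [w] arbitrary, by induction on a pure tensor expansion, and halved
    at the end because [v + star v] is [2 v]. *)
Lemma lambda_cone_order_unit : order_unit K e.
Proof.
split=> [|v vsa]; first by rewrite (star_tens tensP) (unit_sa hS) (unit_sa hT).
have Ge : G e by apply: tens_ground; [exact: ground_unit_pos hS|exact: ground_unit_pos hT].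
have bounded w : exists2 r : R, 0 < r & G (r%:C *: e - (w + star w)).
  have [l ->] := tens_spanned tensP w; rewrite star_sum -big_split /=.
  elim: l => [|[s t] l [r r0 Gr]].
    (* The bound must be strictly positive, so the empty sum uses [e] itself, which lies in the
       cone. *)
    by exists 1 => //; rewrite big_nil subr0 rmorph1 scale1r.
  have [r' r'0 Gr'] := real_part_bounded s t.
  exists (r' + r); first exact: addr_gt0.
  rewrite big_cons rmorphD scalerDl opprD addrACA; exact: groundD.
have [r r0 Gr] := bounded v.
exists (2^-1 * r); first by rewrite mulr_gt0 // invr_gt0.
have := groundZ Kmo (_ : 0 <= 2^-1) Gr; rewrite invr_ge0 ler0n => /(_ isT).
congr K; congr (_%:M); rewrite vsa -mulr2n -scaler_nat scalerBr !scalerA -rmorphM.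
by rewrite -(rmorph_nat (real_complex R)) -rmorphM mulVf ?pnatr_eq0 // scale1r.
Qed.

End Cone.

Theorem theorem4p1 (R : realType) (S T W : starLmodType R)
    (tens : {bilinear S -> T -> W}) (tensP : star_tensor_product tens)
    (PS : forall n : nat, set 'M[S]_n) (oneS : S) (hS : operator_system PS oneS)
    (PT : forall n : nat, set 'M[T]_n) (oneT : T) (hT : operator_system PT oneT)
    (tau : nat -> nat)
    (lam : forall k : nat,
      {bilinear 'M[R[i]]_k -> 'M[R[i]]_k -> 'M[R[i]]_(tau k)})
    (hlam : standing_conditions lam)
    (hO1 : condO1 lam) (hO2 : condO2 lam) (hO3 : condO3 lam) :
  matrix_ordering (lambda_cone lam tens PS PT) /\
  order_unit (lambda_cone lam tens PS PT) (tens oneS oneT).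
Proof.
case: hlam => _ [[tau1 _ _ E2 [lam11 _]] _].
have Kmo := lambda_cone_matrix_ordering tensP hS hT E2 hO3.
by split=> //; exact: lambda_cone_order_unit.
Qed.
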